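(* There is a positive constant $c$ such that for each positive integer $m$, there is a $3$-uniform hypergraph $H$ without isolated vertices and with at most $m$ edges such that the $4$-colour Ramsey number of $H$ satisfies \[ r(H,H,H,H) \ge 2^{2^{c\sqrt{m}}}. \]
   Context: A hypergraph is $3$-uniform if every edge has exactly $3$ vertices. A vertex is isolated if it lies in no edge. The $4$-colour Ramsey number $r(H,H,H,H)$ is the minimum $N$ such that every $4$-colouring of the edges of the complete $3$-uniform hypergraph on $N$ vertices contains a monochromatic copy of $H$ (a not necessarily induced subhypergraph isomorphic to $H$). *)

(* Defs.v *)
From mathcomp Require Import all_boot.

Set Implicit Arguments.
Unset Strict Implicit.
Unset Printing Implicit Defensive.

(* A finite hypergraph with vertex type T is given by its edge set, of type
   {set {set T}}. *)

Definition uniform (k : nat) (T : finType) (H : {set {set T}}) : Prop :=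
  forall e : {set T}, e \in H -> #|e| = k.

Definition isolated (T : finType) (H : {set {set T}}) (v : T) : Prop :=
  forall e : {set T}, e \in H -> v \notin e.

Definition complete_hypergraph (k N : nat) : {set {set 'I_N}} :=
  [set e : {set 'I_N} | #|e| == k].

(* Not necessarily induced: edges of H must go to edges of G, but G may have
   further edges inside the image of f. *)
Definition contains_copy (T U : finType)
    (H : {set {set T}}) (G : {set {set U}}) : Prop :=
  exists f : T -> U, injective f /\ forall e : {set T}, e \in H -> f @: e \in G.

(* A colouring of the edges of the complete k-uniform hypergraph is represented
   by a function on all sets of vertices; its values on sets that do not have
   exactly k elements are irrelevant, as only edges enter a colour class. *)
Definition colour_class (k q N : nat) (chi : {set 'I_N} -> 'I_q) (i : 'I_q) :
    {set {set 'I_N}} :=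
  [set e in complete_hypergraph k N | chi e == i].

Definition ramsey_arrow (k q : nat) (T : finType) (H : {set {set T}})
    (N : nat) : Prop :=
  forall chi : {set 'I_N} -> 'I_q,
    exists i : 'I_q, contains_copy H (colour_class k chi i).

(* r is the q-colour Ramsey number of the k-uniform hypergraph H. *)
Definition is_ramsey_number (k q : nat) (T : finType) (H : {set {set T}})
    (r : nat) : Prop :=
  ramsey_arrow k q H r /\ forall N : nat, ramsey_arrow k q H N -> r <= N.

(* Main.v *)
(* H has vertices a_1, b_1, ..., a_h, b_h, and its edges are the triples that
   contain some pair {a_j, b_j}; thus it has O(h^2) edges, but any two of these
   pairs span a complete 3-graph on four vertices.

   Stepping up: take a 2-colouring g of the pairs of [n], n = 2^(h/4), without
   a monochromatic K_h, and view the 2^n vertices as the leaves of the binary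
   tree of depth n. The leaves of a triple branch off at two levels k < l: one
   leaf leaves the other two at level k, and these separate at level l. Colour
   the triple by g {k, l} together with the side of level k on which the lone
   leaf lies. In a complete 3-graph on {a_i, b_i, a_j, b_j} with constant side,
   the top branching cannot be 2 + 2, so it is 1 + 3; then a_i, b_i and a_j, b_j
   separate at two different levels, which are the levels of some triple. Hence
   a monochromatic copy of H gives h levels forming a monochromatic K_h in g. *)

Require Import Defs.
From mathcomp Require Import all_boot all_order all_algebra.
From mathcomp Require Import reals exp.
From mathcomp Require Import boolp zify lra.

Set Implicit Arguments.
Unset Strict Implicit.
Unset Printing Implicit Defensive.

Import Order.TTheory GRing.Theory Num.Theory.
Local Open Scope nat_scope.

(** * Ramsey's theorem for hypergraphs, so that Ramsey numbers exist *)

Definition homogeneous (T C : finType) (k : nat) (chi : {set T} -> C)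
    (S : {set T}) (c : C) : Prop :=
  forall e : {set T}, e \subset S -> #|e| = k -> chi e = c.

(* Colours have individual targets t c, for the induction on their sum. *)
Definition ramsey_bound (C : finType) (k : nat) (t : C -> nat) (N : nat) :=
  forall (T : finType) (A : {set T}) (chi : {set T} -> C), N <= #|A| ->
    exists c (S : {set T}), [/\ S \subset A, t c <= #|S| &
                                homogeneous k chi S c].

Lemma ramsey_bound0 (C : finType) (t : C -> nat) :
  ramsey_bound 0 t (\max_c t c).
Proof.
move=> T A chi hA; exists (chi set0), A; split=> //.
  exact: leq_trans (leq_bigmax _) hA.
by move=> e _ /eqP; rewrite cards_eq0 => /eqP ->.
Qed.

(** Remove a vertex [x] and colour [k]-sets by [chi (x |: e)]; this has a large homogeneous set [B],
    of colour [c] say. Inside [B], apply induction with the target of [c] lowered by one: if the set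
    found has colour [c], then [x] can be added to it. *)
Lemma ramsey_boundS (C : finType) (k : nat) :
  (forall t : C -> nat, exists N, ramsey_bound k t N) ->
  forall t : C -> nat, exists N, ramsey_bound k.+1 t N.
Proof.
move=> IHk t; have [s] := ubnP (\sum_c t c); elim: s t => // s IHs t lt_ts.
case: (pickP (fun c => t c == 0)) => [c /eqP tc0|t_gt0].
  exists 0 => T A chi _; exists c, set0; rewrite sub0set tc0; split=> // e.
  by rewrite subset0 => /eqP ->; rewrite cards0.
pose u c := fun c' => t c' - (c' == c).
have /fin_all_exists [M hM] (c : C) : exists N, ramsey_bound k.+1 (u c) N.
  apply: IHs; rewrite -ltnS; apply: leq_trans lt_ts.
  rewrite ltnS (bigD1 c) //= [X in _ < X](bigD1 c) //= /u eqxx -addSn leq_add //.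
    by rewrite subn1 prednK // lt0n t_gt0.
  by apply: leq_sum => i _; exact: leq_subr.
(* The colour [c] of [B] is not known in advance, so [B] must be large enough for each of the
   lowered problems. *)
have [N hN] := IHk (fun _ => \max_c M c).
exists N.+1 => T A chi hA.
have /card_gt0P [x xA] : 0 < #|A| by exact: leq_trans hA.
have hAx : N <= #|A :\ x| by rewrite -ltnS (leq_trans hA) // (cardsD1 x A) xA.
have [c [B [sBA hB homB]]] := hN T (A :\ x) (fun e => chi (x |: e)) hAx.
have [c' [S [sSB hS homS]]] := hM c T B chi (leq_trans (leq_bigmax _) hB).
have sSA := subset_trans sSB sBA.
have sS := subset_trans sSA (subD1set A x).
have xNS : x \notin S by apply/negP => /(subsetP sSA); rewrite !inE eqxx.
case: (eqVneq c' c) hS homS => [-> hS homS|nc hS homS]; last first.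
  exists c', S; split=> //.
  by move: hS; rewrite /u (negPf nc) subn0.
have [lecS|ltSc] := leqP (t c) #|S|.
  by exists c, S.
exists c, (x |: S); split.
- by rewrite subUset sub1set xA sS.
- by move: hS; rewrite cardsU1 xNS /u eqxx leq_subLR.
move=> e sexS he; have [xe|xNe] := boolP (x \in e).
  rewrite -(setD1K xe); apply: homB.
    by apply: subset_trans sSB; rewrite subDset.
  by move: he; rewrite (cardsD1 x) xe => -[].
apply: homS => //; apply/subsetP => y ye.
move/subsetP/(_ y ye): sexS; rewrite !inE => /orP[/eqP yx|//].
by rewrite yx (negPf xNe) in ye.
Qed.

Lemma ramsey_bound_ex (C : finType) (k : nat) (t : C -> nat) :
  exists N, ramsey_bound k t N.
Proof.
elim: k t => [t|k IHk]; first by eexists; exact: ramsey_bound0.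
exact: ramsey_boundS.
Qed.

Lemma ramsey_arrow_ex (k q : nat) (T : finType) (H : {set {set T}}) :
  uniform k H -> exists N, ramsey_arrow k q H N.
Proof.
move=> unifH; have [N hN] := ramsey_bound_ex k (fun _ : 'I_q => #|T|).
exists N => chi; have [|c [S [_ hS homS]]] := hN 'I_N setT chi.
  by rewrite cardsT card_ord.
exists c, (fun x : T => enum_val (widen_ord hS (enum_rank x))).
have inj_f : injective (fun x : T => enum_val (widen_ord hS (enum_rank x))).
  by move=> x y /enum_val_inj/(congr1 val)/= /val_inj/enum_rank_inj.
split=> // e eH; rewrite !inE card_imset // unifH // eqxx /=.
apply/eqP/homS; last by rewrite card_imset // unifH.
by apply/subsetP => _ /imsetP[x _ ->]; exact: enum_valP.
Qed.

Lemma is_ramsey_number_ex (k q : nat) (T : finType) (H : {set {set T}}) :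
  uniform k H -> exists r, is_ramsey_number k q H r.
Proof.
move=> /(ramsey_arrow_ex q)[N hN].
have exN : exists N, `[< ramsey_arrow k q H N >] by exists N; exact/asboolP.
case: (ex_minnP exN) => r /asboolP hr minr.
by exists r; split=> // M hM; apply: minr; exact/asboolP.
Qed.

(** * Counting lower bound for graph Ramsey numbers *)

Lemma leq_bin_expn (n h : nat) : 'C(n, h) <= n ^ h.
Proof.
apply: leq_trans (leq_pmulr _ (fact_gt0 h)) _; rewrite bin_ffact.
elim: h n => [|h IHh] [|n] //; rewrite ffactnS expnS leq_mul //=.
by apply: leq_trans (IHh n) _; case: h {IHh} => // h; rewrite leq_exp2r.
Qed.

(** Values are forced on [P] and free off it; the product form avoids subtraction in the
    exponent. *)
Lemma card_constant_on (T : finType) (P : {set T}) (c : bool) :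
  #|[set g : {ffun T -> bool} | [forall x in P, g x == c]]| * 2 ^ #|P|
  = 2 ^ #|T|.
Proof.
pose F (x : T) : pred bool := if x \in P then pred1 c else predT.
have -> : #|[set g : {ffun T -> bool} | [forall x in P, g x == c]]|
          = #|family F|.
  apply: eq_card => g; rewrite inE; apply/forall_inP/familyP => [h x|h x xP].
    by rewrite /F; case: ifP => // /h.
  by have := h x; rewrite /F xP.
rewrite card_family foldrE big_map big_enum /=.
rewrite (bigID (mem P)) /= big1 ?mul1n; last first.
  by move=> x xP; rewrite /F xP card1.
rewrite (eq_bigr (fun=> 2)) => [|x xNP]; last first.
  by rewrite /F (negPf xNP) card_bool.
by rewrite prod_nat_const -expnD addnC cardC.
Qed.

(* Union bound over all 2-colourings of the subsets, of which only those of the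
   pairs matter. *)
Lemma ramsey_graph_lower (n h : nat) : 2 * n ^ h < 2 ^ 'C(h, 2) ->
  exists g : {set 'I_n} -> bool, forall (S : {set 'I_n}) (c : bool),
    #|S| = h -> ~ homogeneous 2 g S c.
Proof.
move=> lt_nh; apply/not_existsP => bad.
pose P (S : {set 'I_n}) := [set e : {set 'I_n} | e \subset S & #|e| == 2].
pose B (Sc : {set 'I_n} * bool) :=
  [set g : {ffun {set 'I_n} -> bool} | [forall e in P Sc.1, g e == Sc.2]].
pose D := [set Sc : {set 'I_n} * bool | #|Sc.1| == h].
have cover : [set: {ffun {set 'I_n} -> bool}] \subset \bigcup_(Sc in D) B Sc.
  apply/subsetP => g _; have /existsNP[S /existsNP[c]] := bad g.
  move=> /not_implyP[hS /contrapT homS].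
  apply/bigcupP; exists (S, c); first by rewrite inE hS.
  rewrite inE; apply/forall_inP => e; rewrite inE => /andP[seS /eqP he].
  exact/eqP/homS.
have cardD : #|D| <= 2 * n ^ h.
  have -> : D = setX [set S : {set 'I_n} | #|S| == h] setT.
    by apply/setP => -[S c]; rewrite !inE andbT.
  by rewrite cardsX cardsT card_bool card_draws card_ord mulnC leq_mul2l leq_bin_expn.
have := subset_leq_card cover; rewrite cardsT card_ffun card_bool.
(* After scaling by [2 ^ 'C(h, 2)], every bad event contributes exactly the number of all
   colourings. *)
apply/negP; rewrite -ltnNge -(ltn_pmul2r (expn_gt0 2 'C(h, 2))).
apply: (@leq_ltn_trans (\sum_(Sc in D) #|B Sc| * 2 ^ 'C(h, 2))).
  rewrite -big_distrl /= leq_mul2r; apply/orP; right.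
  elim/big_rec2: _ => [|Sc m A _ leAm]; first by rewrite cards0.
  by rewrite (leq_trans (leq_card_setU _ _)) // leq_add2l.
rewrite (eq_bigr (fun=> 2 ^ #|{set 'I_n}|)) => [|Sc]; last first.
  by rewrite inE => /eqP <-; rewrite -cards_draws card_constant_on.
rewrite sum_nat_const mulnC ltn_pmul2l ?expn_gt0 //.
exact: leq_ltn_trans cardD lt_nh.
Qed.

(** * Stepping up: leaves of the binary tree of depth [n] *)

Section StepUp.
Variable n : nat.
Implicit Types (x y p q r : {ffun 'I_n -> bool}) (i j : 'I_n).

Definition first_diff x y i : bool :=
  (x i != y i) && [forall j : 'I_n, (j < i) ==> (x j == y j)].

Lemma first_diffC x y i : first_diff x y i = first_diff y x i.
Proof.
by rewrite /first_diff eq_sym; congr andb; apply: eq_forallb => j; rewrite eq_sym.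
Qed.

Lemma first_diff_ex x y : x != y -> exists i, first_diff x y i.
Proof.
move=> nxy; have /existsP[i0 hi0] : [exists i, x i != y i].
  rewrite -negb_forall; apply: contra nxy => /forallP h.
  by apply/eqP/ffunP => i; exact/eqP.
case: (@arg_minnP _ i0 (fun i => x i != y i) val hi0) => i hi mini.
exists i; rewrite /first_diff hi; apply/forallP => j; apply/implyP => ltji.
by apply: contraTT ltji => /mini; rewrite -leqNgt.
Qed.

Lemma first_diff_uniq x y i j : first_diff x y i -> first_diff x y j -> i = j.
Proof.
move=> /andP[ni /forallP hi] /andP[nj /forallP hj]; apply: val_inj.
case: (ltngtP i j) => // [lt|lt].
  by move: (hj i); rewrite lt (negPf ni).
by move: (hi j); rewrite lt (negPf nj).
Qed.

Lemma first_diff_neq x y i : first_diff x y i -> x != y.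
Proof. by move=> /andP[nxy _]; apply: contraNneq nxy => ->. Qed.

Definition levels (e : {set {ffun 'I_n -> bool}}) : {set 'I_n} :=
  [set i | [exists x in e, exists y in e, first_diff x y i]].

(* On a triple: the bit of the lone leaf at the level where it leaves the other
   two. *)
Definition lone_bit (e : {set {ffun 'I_n -> bool}}) : bool :=
  [exists r in e, exists i,
    [forall x in e, (x != r) ==> first_diff x r i && r i]].

Lemma levels_triple p q r i j :
  first_diff p r i -> first_diff q r i -> first_diff p q j ->
  levels [set r; p; q] = [set i; j].
Proof.
move=> pri qri pqj; apply/setP => k; rewrite !inE; apply/idP/idP.
  move=> /exists_inP[x + /exists_inP[y]]; rewrite !inE.
  have nd z l : first_diff z z l = false by rewrite /first_diff eqxx.
  move=> /orP[/orP[]|] /eqP-> /orP[/orP[]|] /eqP->; rewrite ?nd // => h.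
  - by rewrite first_diffC in h; rewrite (first_diff_uniq h pri) eqxx.
  - by rewrite first_diffC in h; rewrite (first_diff_uniq h qri) eqxx.
  - by rewrite (first_diff_uniq h pri) eqxx.
  - by rewrite (first_diff_uniq h pqj) eqxx orbT.
  - by rewrite (first_diff_uniq h qri) eqxx.
  - by rewrite first_diffC in h; rewrite (first_diff_uniq h pqj) eqxx orbT.
move=> /orP[]/eqP->; apply/exists_inP; exists p; rewrite ?inE ?eqxx ?orbT //;
  apply/exists_inP.
- by exists r; rewrite ?inE ?eqxx.
- by exists q; rewrite ?inE ?eqxx ?orbT.
Qed.

Lemma lone_bit_triple p q r i : p != q ->
  first_diff p r i -> first_diff q r i -> lone_bit [set r; p; q] = r i.
Proof.
move=> npq pri qri; apply/idP/idP => [|ri]; last first.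
  apply/exists_inP; exists r; first by rewrite !inE eqxx.
  apply/existsP; exists i; apply/forall_inP => x; rewrite !inE ri andbT.
  by move=> /orP[/orP[]|] /eqP->; rewrite ?eqxx ?pri ?qri ?implybT.
(* Only [r] can be the lone leaf: if [v] also left the other two at a single level, that level would
   be [i], where three bits would be pairwise distinct. *)
have side u v w : first_diff v u i -> first_diff w u i -> v != w ->
    ~ [exists k, [forall x in [set u; v; w], (x != v) ==> first_diff x v k && v k]].
  move=> vui wui nvw /existsP[k /forall_inP h].
  have := h u; rewrite !inE eqxx ?orbT /= => /(_ isT).
  rewrite eq_sym (first_diff_neq vui) => /andP[uvk _].
  have := h w; rewrite !inE eqxx ?orbT /= => /(_ isT).
  rewrite eq_sym nvw => /andP[wvk _].
  rewrite first_diffC in uvk.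
  have ki := first_diff_uniq uvk vui; rewrite {}ki in uvk wvk.
  move: vui wui wvk => /andP[+ _] /andP[+ _] /andP[+ _].
  by case: (u i); case: (v i); case: (w i).
move=> /exists_inP[x]; rewrite !inE => /orP[/orP[]|] /eqP->.
- move=> /existsP[k /forall_inP h].
  have := h p; rewrite !inE eqxx ?orbT /= => /(_ isT).
  rewrite (first_diff_neq pri) => /andP[prk rk].
  by rewrite (first_diff_uniq pri prk).
- by move=> h; case: (side r p q pri qri npq).
- rewrite -setUA [[set p] :|: _]setUC setUA => h.
  by case: (side r q p qri pri); rewrite 1?eq_sym.
Qed.

(** This will be applied to two of the pairs of [H]: [i != j] makes the map from pairs to levels
    injective, and the value of [g] makes its image homogeneous. *)
Lemma step_up_four_points (g : {set 'I_n} -> bool) (t c : bool) x1 y1 x2 y2 i j :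
  (forall r p q, r \in [:: x1; y1; x2; y2] -> p \in [:: x1; y1; x2; y2] ->
     q \in [:: x1; y1; x2; y2] -> r != p -> r != q -> p != q ->
     lone_bit [set r; p; q] = t /\ g (levels [set r; p; q]) = c) ->
  uniq [:: x1; y1; x2; y2] -> first_diff x1 y1 i -> first_diff x2 y2 j ->
  i != j /\ g [set i; j] = c.
Proof.
set Q := [:: x1; y1; x2; y2] => mono uniqQ d1 d2.
have [mx1 my1 mx2 my2] : [/\ x1 \in Q, y1 \in Q, x2 \in Q & y2 \in Q].
  by rewrite !inE !eqxx !orbT.
(* [k] is the level of the top branching of the four leaves. *)
have [k [nk hk]] : exists k, ~~ [&& x1 k == y1 k, x1 k == x2 k & x1 k == y2 k] /\
    forall x y, x \in Q -> y \in Q -> x k != y k -> first_diff x y k.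
  pose P := fun k => ~~ [&& x1 k == y1 k, x1 k == x2 k & x1 k == y2 k].
  have Pi : P i by move: d1 => /andP[/negPf h _]; rewrite /P h.
  case: (@arg_minnP _ i P val Pi) => k nk mink; exists k; split=> // x y xQ yQ nxy.
  rewrite /first_diff nxy; apply/forallP => l; apply/implyP => ltlk.
  have : ~~ P l by apply: contraTN ltlk => /mink; rewrite -leqNgt.
  rewrite negbK => /and3P[/eqP e1 /eqP e2 /eqP e3].
  suff h z : z \in Q -> z l = x1 l by rewrite !h.
  by rewrite !inE => /or4P[] /eqP->.
(* If [r] parts from [p] and [q] at [k], then [k] and the later level [l] at which [p] and [q]
   separate are the levels of this triple. *)
have lone r p q l : r \in Q -> p \in Q -> q \in Q ->
    r k != p k -> p k == q k -> first_diff p q l -> k != l /\ g [set k; l] = c.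
  move=> rQ pQ qQ nrp /eqP epq pql; split.
    by apply: contraTneq pql => <-; rewrite /first_diff epq eqxx.
  have prk : first_diff p r k by apply: hk; rewrite // eq_sym.
  have qrk : first_diff q r k by apply: hk; rewrite // -epq eq_sym.
  rewrite -(levels_triple prk qrk pql).
  have [] // := mono r p q; rewrite ?(first_diff_neq pql) // eq_sym.
    exact: first_diff_neq prk.
  exact: first_diff_neq qrk.
(* In a 2 + 2 split, r p q and p r s would have lone leaves on opposite sides. *)
have split22 r s p q : r \in Q -> s \in Q -> p \in Q -> q \in Q ->
    r != s -> p != q -> r k == s k -> p k == q k -> r k != p k -> False.
  move=> rQ sQ pQ qQ nrs npq /eqP ers /eqP epq nrp.
  have rp : first_diff r p k by apply: hk.
  have sp : first_diff s p k by apply: hk; rewrite -?ers.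
  have rq : first_diff r q k by apply: hk; rewrite -?epq.
  have [pr qr] : first_diff p r k /\ first_diff q r k by rewrite ![first_diff _ r _]first_diffC.
  have [t1 _] : lone_bit [set r; p; q] = t /\ g (levels [set r; p; q]) = c.
    by apply: mono; rewrite // ?(first_diff_neq rp) ?(first_diff_neq rq).
  have [t2 _] : lone_bit [set p; r; s] = t /\ g (levels [set p; r; s]) = c.
    by apply: mono; rewrite // eq_sym ?(first_diff_neq rp) ?(first_diff_neq sp).
  move: nrp; rewrite -(lone_bit_triple npq pr qr) -(lone_bit_triple nrs rp sp).
  by rewrite t1 t2 eqxx.
move: uniqQ; rewrite /= !inE !negb_or => /and4P[/and3P[n12 n13 n14] /andP[n23 n24] n34 _].
have i_eq : x1 k != y1 k -> i = k by move/(hk _ _ mx1 my1) => /(first_diff_uniq d1).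
have j_eq : x2 k != y2 k -> j = k by move/(hk _ _ mx2 my2) => /(first_diff_uniq d2).
have s22 := split22 x1 y1 x2 y2 mx1 my1 mx2 my2 n12 n34.
have s23 := split22 x1 x2 y1 y2 mx1 mx2 my1 my2 n13 n24.
have n32 : x2 != y1 by rewrite eq_sym.
have n42 : y2 != y1 by rewrite eq_sym.
have s24 := split22 x1 y2 y1 x2 mx1 my2 my1 mx2 n14 n23.
have l1 := fun a b => lone x1 x2 y2 j mx1 mx2 my2 a b d2.
have l2 := fun a b => lone y1 x2 y2 j my1 mx2 my2 a b d2.
have l3 := fun a b => lone x2 x1 y1 i mx2 mx1 my1 a b d1.
have l4 := fun a b => lone y2 x1 y1 i my2 mx1 my1 a b d1.
move: nk i_eq j_eq s22 s23 s24 l1 l2 l3 l4.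
have swap : k != i /\ g [set k; i] = c -> i != k /\ g [set i; k] = c.
  by rewrite eq_sym setUC.
(* All bit patterns at [k]: the three 2 + 2 splits are refuted by [s1], [s2], [s3]; in a 1 + 3 split
   the pair with the lone leaf separates at [k], and the lone leaf with the other pair forms the
   triple needed. *)
case: (x1 k); case: (y1 k); case: (x2 k); case: (y2 k) => //= _ ei ej s1 s2 s3 l1 l2 l3 l4;
  first [ by case: s1 | by case: s2 | by case: s3
        | by rewrite (ei isT); first [exact: l1 | exact: l2]
        | by rewrite (ej isT); apply: swap; first [exact: l3 | exact: l4] ].
Qed.
End StepUp.

(** * The hypergraph [H] and its double exponential lower bound *)

Definition matching_hypergraph (h : nat) : {set {set 'I_h * bool}} :=
  [set e : {set 'I_h * bool} | #|e| == 3 & [exists j, [set (j, false); (j, true)] \subset e]].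

Lemma matching_hypergraph_uniform (h : nat) : uniform 3 (matching_hypergraph h).
Proof. by move=> e; rewrite inE => /andP[/eqP]. Qed.

Lemma cards3 (T : finType) (x y z : T) :
  x != y -> x != z -> y != z -> #|[set x; y; z]| = 3.
Proof.
move=> xy xz yz; rewrite setUC cardsU1 cards2 xy !inE negb_or.
by rewrite ![z == _]eq_sym xz yz.
Qed.

(** An edge is determined by a pair inside it ([h] choices) and its third vertex (at most [2 * h]
    choices). *)
Lemma card_matching_hypergraph (h : nat) : #|matching_hypergraph h| <= 2 * h ^ 2.
Proof.
pose F (jv : 'I_h * ('I_h * bool)) := [set (jv.1, false); (jv.1, true)] :|: [set jv.2].
apply: (@leq_trans #|F @: setT|); last first.
  apply: leq_trans (leq_imset_card _ _) _.
  by rewrite cardsT !card_prod card_ord card_bool; lia.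
apply/subset_leq_card/subsetP => e; rewrite inE => /andP[/eqP he /existsP[j sje]].
have /eqP/cards1P[v hv] : #|e :\: [set (j, false); (j, true)]| = 1.
  by rewrite cardsD (setIidPr sje) he cards2 xpair_eqE andbF.
apply/imsetP; exists (j, v); rewrite ?inE // /F /= -hv setUC.
by rewrite -[in LHS](setID e [set (j, false); (j, true)]) (setIidPr sje) setUC.
Qed.

Lemma matching_hypergraph_not_isolated (h : nat) (v : 'I_h * bool) :
  1 < h -> ~ isolated (matching_hypergraph h) v.
Proof.
case: v => j b h_gt1 iso.
have [j' nj] : exists j' : 'I_h, j != j'.
  have [j0|jn0] := eqVneq (val j) 0.
    by exists (Ordinal h_gt1); rewrite -val_eqE /= j0.
  by exists (Ordinal (ltnW h_gt1)); rewrite -val_eqE.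
have: (j, b) \notin [set (j, false); (j, true); (j', true)].
  apply: iso; rewrite inE cards3 ?xpair_eqE ?eqxx ?(negPf nj) //=.
  by apply/existsP; exists j; exact: subsetUl.
by rewrite !inE !xpair_eqE eqxx; case: b {iso}.
Qed.

Lemma matching_hypergraph_ramsey_lower (n h r : nat) (g : {set 'I_n} -> bool) :
  (forall (S : {set 'I_n}) (c : bool), #|S| = h -> ~ homogeneous 2 g S c) ->
  ramsey_arrow 3 4 (matching_hypergraph h) r -> 2 ^ n < r.
Proof.
move=> hg arrow; rewrite ltnNge; apply/negP => le_r.
have le_rV : r <= #|{ffun 'I_n -> bool}| by rewrite card_ffun card_bool card_ord.
pose v (i : 'I_r) := enum_val (widen_ord le_rV i).
have inj_v : injective v by move=> i j /enum_val_inj/(congr1 val)/= /val_inj.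
(* The four colours are the two-bit numbers: high bit for the side, low bit for [g]. *)
pose colour (b1 b2 : bool) : 'I_4 := inord (b1.*2 + b2).
have colourE b1 b2 k : colour b1 b2 = k -> b1 = (1 < k) /\ b2 = odd k.
  by move=> <-; rewrite /colour inordK; case: b1; case: b2.
have [k [f [inj_f copy]]] := arrow (fun e => colour (lone_bit (v @: e)) (g (levels (v @: e)))).
pose F := v \o f; have inj_F : injective F by exact: inj_comp.
have mono e : e \in matching_hypergraph h ->
    lone_bit (F @: e) = (1 < k) /\ g (levels (F @: e)) = odd k.
  move=> /copy; rewrite !inE => /andP[_ /eqP/colourE].
  by rewrite -imset_comp.
have /fin_all_exists[d hd] (j : 'I_h) : exists i, first_diff (F (j, false)) (F (j, true)) i.
  by apply: first_diff_ex; rewrite (inj_eq inj_F) xpair_eqE andbF.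
have key i j : i != j -> d i != d j /\ g [set d i; d j] = odd k.
  move=> nij; apply: (@step_up_four_points _ g (1 < k) (odd k) _ _ _ _ _ _ _ _ (hd i) (hd j)).
    have mapF x : x \in [:: F (i, false); F (i, true); F (j, false); F (j, true)] ->
        exists2 u, x = F u & (u.1 == i) || (u.1 == j).
      rewrite !inE => /or4P[] /eqP->; [exists (i, false) | exists (i, true)
        | exists (j, false) | exists (j, true)]; by rewrite //= eqxx ?orbT.
    move=> _ _ _ /mapF[[i1 b1] -> /= h1] /mapF[[i2 b2] -> /= h2] /mapF[[i3 b3] -> /= h3].
    rewrite !(inj_eq inj_F) => n12 n13 n23.
    have -> : [set F (i1, b1); F (i2, b2); F (i3, b3)]
              = F @: [set (i1, b1); (i2, b2); (i3, b3)] by rewrite !imsetU !imset_set1.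
    apply: mono; rewrite inE cards3 //=; apply/existsP.
    (* By pigeonhole two of the three distinct vertices share an index, so they form a whole pair
       and the triple is an edge. *)
    move: h1 h2 h3 n12 n13 n23 => /orP[]/eqP-> /orP[]/eqP-> /orP[]/eqP->;
      rewrite ?xpair_eqE ?eqxx /= => n12 n13 n23;
      first [exists i; rewrite subUset !sub1set !inE !xpair_eqE !eqxx /=;
               by move: b1 b2 b3 n12 n13 n23; do 3!case; rewrite /= ?orbT
           | exists j; rewrite subUset !sub1set !inE !xpair_eqE !eqxx /=;
               by move: b1 b2 b3 n12 n13 n23; do 3!case; rewrite /= ?orbT].
  by rewrite /= !inE !(inj_eq inj_F) !xpair_eqE !eqxx (negPf nij).
have inj_d : injective d.
  by move=> i j dij; apply/eqP; apply: contraT => /key[]; rewrite dij eqxx.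
apply: (hg [set d j | j in setT] (odd k)).
  by rewrite card_imset // cardsT card_ord.
move=> e sed /eqP/cards2P[a [b [nab def_e]]]; rewrite def_e.
have /imsetP[i _ da] : a \in d @: setT by apply: (subsetP sed); rewrite def_e !inE eqxx.
have /imsetP[j _ db] : b \in d @: setT by apply: (subsetP sed); rewrite def_e !inE eqxx orbT.
by rewrite da db; apply: (key i j _).2; apply: contraNneq nab => ij; rewrite da db ij.
Qed.

Lemma matching_hypergraph_ramsey_double_exp (d r : nat) : 0 < d ->
  ramsey_arrow 3 4 (matching_hypergraph (4 * d)) r -> 2 ^ 2 ^ d < r.
Proof.
move=> d_gt0; have [|g hg] := @ramsey_graph_lower (2 ^ d) (4 * d); last first.
  exact: matching_hypergraph_ramsey_lower hg.
(* In the exponents this is [4 * d ^ 2 + 1 < 2 * d * (4 * d - 1)], true for [d >= 1]. *)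
rewrite -expnM -expnS ltn_exp2l // bin2.
have -> : 4 * d * (4 * d).-1 = (2 * d * (4 * d).-1).*2 by lia.
by rewrite doubleK; nia.
Qed.

(** * Small [m], real estimates and the choice of constants *)

Lemma single_edge_ramsey_lower (r : nat) :
  ramsey_arrow 3 4 [set [set: 'I_3]] r -> 3 <= r.
Proof.
move=> /(_ (fun=> ord0))[_ [f [inj_f _]]].
by have := leq_card f inj_f; rewrite !card_ord.
Qed.

Lemma sqrt_nat_le (R : realType) (m s : nat) :
  m <= s ^ 2 -> (Num.sqrt m%:R <= s%:R :> R)%R.
Proof.
move=> le_m; rewrite -[leRHS]ger0_norm // -sqrtr_sqr -natrX.
by rewrite ler_sqrt // ler_nat.
Qed.

Lemma double_exp_le (R : realType) (x y : R) : (x <= y)%R ->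
  (2 `^ (2 `^ x) <= 2 `^ (2 `^ y) :> R)%R.
Proof. by move=> xy; rewrite !ler_powR // ler1n. Qed.

(** The bound 3/2 for the square root of 2 is used twice: in the exponent, and then in estimating 2
    to the power 3/2 as twice that root. *)
Lemma double_exp_half_le3 (R : realType) : (2 `^ (2 `^ 2^-1) <= 3 :> R)%R.
Proof.
have le32 : (2 `^ 2^-1 <= 3 / 2 :> R)%R.
  rewrite powR12_sqrt // -[leRHS]ger0_norm; last by lra.
  by rewrite -sqrtr_sqr ler_sqrt; [lra | nra].
apply: (@le_trans _ _ (2 `^ (1 + 2^-1) : R)%R).
  by rewrite ler_powR ?ler1n //; lra.
rewrite powRD ?powRr1 //; last by apply/implyP => /eqP; lra.
by rewrite -ler_pdivlMl //; lra.
Qed.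

Local Open Scope ring_scope.

Theorem corollary2 (R : realType) :
  exists c : R, 0 < c /\
    forall m : nat, (0 < m)%N ->
      exists (T : finType) (H : {set {set T}}),
        [/\ uniform 3 H,
            (forall v : T, ~ isolated H v),
            (#|H| <= m)%N &
            exists r : nat, is_ramsey_number 3 4 H r /\
              2 `^ (2 `^ (c * Num.sqrt m%:R)) <= r%:R].
Proof.
exists 16^-1; split=> [|m m_gt0]; first by rewrite invr_gt0.
(* With [h = 4 * d] the edge bound [2 * h ^ 2] is [32 * d ^ 2]. For [d >= 1],
   [m < 32 * d.+1 ^ 2 <= (16 * d) ^ 2], whence the constant 1/16. *)
have [d /andP[le_dm lt_md]] : exists d, (32 * d ^ 2 <= m < 32 * d.+1 ^ 2)%N.
  elim: m {m_gt0} => [|m [d hd]]; first by exists 0%N.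
  by have [lt|le] := ltnP m.+1 (32 * d.+1 ^ 2); [exists d | exists d.+1]; lia.
case: (posnP d) => [d0|d_gt0].
  (* Here [m < 32 <= 8 ^ 2], so the inner exponent is at most 1/2 and a single edge, with Ramsey
     number at least 3, suffices. *)
  exists 'I_3, [set [set: 'I_3]].
  have unif : uniform 3 [set [set: 'I_3]].
    by move=> e /set1P ->; rewrite cardsT card_ord.
  have [r ramsey_r] := is_ramsey_number_ex 4 unif.
  split=> //; last 1 first.
  - exists r; split=> //; apply: (@le_trans _ _ 3); last first.
      by rewrite ler_nat; apply: single_edge_ramsey_lower ramsey_r.1.
    apply: le_trans (double_exp_half_le3 R); apply: double_exp_le.
    have : Num.sqrt m%:R <= 8%:R :> R by apply: sqrt_nat_le; rewrite d0 in lt_md; lia.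
    by lra.
  - by move=> v /(_ [set: 'I_3]); rewrite !inE eqxx => /(_ isT).
  - by rewrite cards1.
have unif := @matching_hypergraph_uniform (4 * d).
have [r ramsey_r] := is_ramsey_number_ex 4 unif.
exists _, (matching_hypergraph (4 * d)); split=> //.
- by move=> v; apply: matching_hypergraph_not_isolated; lia.
- by apply: leq_trans (card_matching_hypergraph _) _; lia.
exists r; split=> //.
have lt_r := matching_hypergraph_ramsey_double_exp d_gt0 ramsey_r.1.
apply: (@le_trans _ _ (2 ^ 2 ^ d)%:R); last by rewrite ler_nat ltnW.
rewrite natrX -powR_mulrn // natrX -powR_mulrn //; apply: double_exp_le.
have : Num.sqrt m%:R <= (16 * d)%:R :> R by apply: sqrt_nat_le; nia.
by rewrite natrM; lra.
Qed.
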